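(* Let $m\geq 1$ be an integer, let $G$ be the multigraph obtained from the complete graph $K_5$ by replacing each edge with $m$ parallel edges, and let $\Sigma=(G,\sigma)$ be a signed multigraph in which exactly one edge is positive and all remaining edges are negative. Then $$\chi'(\Sigma)=\Delta(G)+\mu(G)=5m.$$
   Context: Multigraphs are finite and loopless; parallel edges are allowed. $\Delta(G)$ is the maximum degree of $G$, and $\mu(G)$ is the maximum, over pairs of distinct vertices $u,v$, of the number of edges joining $u$ and $v$. A signed multigraph $\Sigma=(G,\sigma)$ consists of a multigraph $G$ and a signature $\sigma:E(G)\to\{1,-1\}$; an edge $e$ is positive if $\sigma(e)=1$ and negative if $\sigma(e)=-1$. Each edge $e=uv$ consists of two half-edges: $h_e^u$ at $u$ and $h_e^v$ at $v$. $H(G)$ is the set of all half-edges of $G$, and $H_G(v)$ the set of half-edges at $v$. For a nonnegative integer $k$, let $M_k=\{-r,\dots,-1\}\cup\{1,\dots,r\}$ if $k=2r$, and $M_k=\{-r,\dots,r\}$ (including $0$) if $k=2r+1$. A $k$-edge-coloring of $\Sigma$ is a mapping $\gamma:H(G)\to M_k$ such that the colors of the half-edges in $H_G(v)$ are pairwise distinct for every $v\in V(G)$, and $\gamma(h_e^u)=-\sigma(e)\gamma(h_e^v)$ for every edge $e=uv\in E(G)$. The chromatic index $\chi'(\Sigma)$ is the least nonnegative integer $k$ for which $\Sigma$ has a $k$-edge-coloring. *)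

(* Defs.v *)
From mathcomp Require Import all_boot all_order all_algebra.

Set Implicit Arguments.
Unset Strict Implicit.
Unset Printing Implicit Defensive.

Import GRing.Theory Num.Theory.

Local Open Scope ring_scope.

(* The two booleans name the two ends of an edge, in an arbitrary order; the  *)
(* pair (e, b) : edge G * bool is the half-edge of e at its end [endpt e b].  *)
Record multigraph := Multigraph {
  vertex : finType;
  edge : finType;
  endpt : edge -> bool -> vertex;
  loopless : forall e, endpt e false != endpt e true }.

Section Multigraph.
Variable G : multigraph.

Definition half_edge : finType := (edge G * bool)%type.

Definition half_edges_at (v : vertex G) : {set half_edge} :=
  [set h | endpt h.1 h.2 == v].

Definition degree (v : vertex G) : nat := #|half_edges_at v|.

Definition max_degree : nat := \max_(v : vertex G) degree v.

Definition edges_joining (u v : vertex G) : {set edge G} :=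
  [set e | [exists b, (endpt e b == u) && (endpt e (~~ b) == v)]].

Definition max_multiplicity : nat :=
  \max_(u : vertex G) \max_(v : vertex G | u != v) #|edges_joining u v|.

Record signature := Signature {
  sign_of :> edge G -> int;
  sign_ofP : forall e, (sign_of e == 1) || (sign_of e == -1) }.

End Multigraph.

(* k = 2r or k = 2r + 1 with r = k./2; 0 is a color exactly when k is odd.    *)
Definition colors (k : nat) : seq int :=
  [seq - j%:Z | j <- iota 1 k./2] ++ nseq (odd k) 0
    ++ [seq j%:Z | j <- iota 1 k./2].

Section Coloring.
Variables (G : multigraph) (sigma : signature G).

Definition is_edge_coloring (k : nat)
    (gamma : {ffun half_edge G -> seq_sub (colors k)}) : bool :=
  [forall v, dinjectiveb gamma (half_edges_at v)] &&
  [forall e, forall b,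
     ssval (gamma (e, b)) == - sigma e * ssval (gamma (e, ~~ b))].

Definition edge_colorable (k : nat) : bool :=
  [exists gamma, @is_edge_coloring k gamma].

(* Give each edge its own pair of opposite nonzero colors.                    *)
Lemma edge_colorable_ex : exists k, edge_colorable k.
Proof.
pose c (e : edge G) : int := (enum_rank e).+1%:Z.
pose f (h : half_edge G) : int := if h.2 then c h.1 else - sigma h.1 * c h.1.
have fM h : f h \in colors #|edge G|.*2.
  have cI : (enum_rank h.1).+1 \in iota 1 #|edge G|.
    by rewrite mem_iota add1n !ltnS; apply: ltn_ord.
  rewrite /colors doubleK odd_double !mem_cat /f; case: h.2.
    by rewrite (map_f (fun j : nat => j%:Z) cI) !orbT.
  case/orP: (sign_ofP sigma h.1) => /eqP ->; rewrite ?mulN1r ?opprK ?mul1r.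
    by rewrite (map_f (fun j : nat => - j%:Z) cI).
  by rewrite (map_f (fun j : nat => j%:Z) cI) !orbT.
exists #|edge G|.*2; apply/existsP; exists [ffun h => SeqSub (fM h)].
apply/andP; split; last first.
  apply/forallP => e; apply/forallP => b; rewrite !ffunE /= /f /=.
  case: b => //=; rewrite mulrA mulrNN.
  by case/orP: (sign_ofP sigma e) => /eqP ->; rewrite ?mulrNN !mul1r.
apply/forallP => v; apply/dinjectiveP => [[e b] [e' b']].
rewrite !inE /= => /eqP ev /eqP e'v; rewrite !ffunE => /(congr1 (@ssval _ _)) /=.
have absf h : `|f h|%N = (enum_rank h.1).+1.
  rewrite /f; case: h.2 => //.
  by case/orP: (sign_ofP sigma h.1) => /eqP ->; rewrite ?mulN1r ?opprK ?mul1r.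
move=> /(congr1 absz); rewrite !absf /= => -[] /val_inj /enum_rank_inj ee'.
subst e'; congr (_, _); apply/eqP; move: (loopless e).
by case: b b' ev e'v => [] [] // -> ->; rewrite eqxx.
Qed.

Definition chromatic_index : nat := ex_minn edge_colorable_ex.

End Coloring.

Definition complete (n : nat) : multigraph :=
  @Multigraph 'I_n {p : 'I_n * 'I_n | (p.1 < p.2)%N}
    (fun p b => if b then (val p).2 else (val p).1)
    (fun p => negbT (ltn_eqF (valP p))).

Definition inflate (m : nat) (G : multigraph) : multigraph :=
  @Multigraph (vertex G) (edge G * 'I_m)%type
    (fun e b => endpt e.1 b)
    (fun e => loopless e.1).

(* Main.v *)
Require Import Defs.
From mathcomp Require Import all_boot all_order all_algebra.
From mathcomp Require Import all_fingroup zify.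

(** Lower bound: a color class of negative edges is a matching, so it has at
    most 2 edges on 5 vertices; the 10m - 1 negative edges therefore need at
    least 5m colors.

    Upper bound: color the edge joining a and b in the j-th copy of K_5 by the
    class (a + b mod 5, j); the class (2u, j) misses the vertex u.  If u and v
    are the ends of the positive edge and j its copy, the half-edge at u can thus
    be moved from (u + v, j) to (2u, j), and it remains to inject the 5m classes
    into the 5m colors so that these two distinct classes get opposite colors. *)

Set Implicit Arguments.
Unset Strict Implicit.
Unset Printing Implicit Defensive.

Import GRing.Theory Num.Theory.

Local Open Scope ring_scope.

(** * The color set $M_k$ and injections into it *)

Lemma size_colors k : size (colors k) = k.
Proof.
rewrite /colors !size_cat !size_map size_nseq size_iota.
by rewrite addnCA addnn odd_double_half.
Qed.

Lemma colors_uniq k : uniq (colors k).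
Proof.
have pos_inj : injective (fun j : nat => j%:Z) by move=> i j [].
have neg_inj : injective (fun j : nat => - j%:Z) by move=> i j /oppr_inj [].
rewrite /colors !cat_uniq (map_inj_uniq neg_inj) (map_inj_uniq pos_inj) iota_uniq.
apply/and3P; split => //.
- apply/hasPn => x; rewrite mem_cat => /orP[] xP; apply/negP => /mapP[i].
    move: xP; rewrite mem_nseq => /andP[_ /eqP ->].
    by case: i => [|i] //; rewrite mem_iota.
  by case/mapP: xP => [[|j]]; rewrite mem_iota // => _ ->; case: i.
- rewrite andbT; apply/andP; split; first by case: odd.
  apply/hasPn => _ /mapP[[|i] + ->]; rewrite mem_iota //.
  by case: odd.
Qed.

Lemma card_colors k : #|{: seq_sub (colors k)}| = k.
Proof. by rewrite card_seq_sub ?size_colors ?colors_uniq. Qed.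

(** The two halves of the positive edge will receive these colors. The bound on [k] excludes $M_1$,
    which contains only 0. *)
Lemma mem1_colors k : (1 < k)%N -> (1 \in colors k) && (-1 \in colors k).
Proof.
move=> k_gt1; have j1 : 1%N \in iota 1 k./2 by rewrite mem_iota; lia.
rewrite /colors !mem_cat (map_f (fun j : nat => j%:Z) j1).
by rewrite (map_f (fun j : nat => - j%:Z) j1) !orbT.
Qed.

(** Any injection can be corrected by two transpositions of the target: the first sends the image of
    [a] to [x], the second the new image of [b] to [y]. The second one fixes [x], which is neither
    [y] nor the image of [b]. *)
Lemma injection_with_two_values (S T : finType) (a b : S) (x y : T) :
  (#|S| <= #|T|)%N -> a != b -> x != y ->
  exists f : S -> T, [/\ injective f, f a = x & f b = y].
Proof.
move=> leST neab nexy.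
pose g s : T := enum_val (widen_ord leST (enum_rank s)).
have g_inj : injective g.
  by move=> s t /enum_val_inj /(congr1 val) /= /val_inj /enum_rank_inj.
pose g1 := tperm (g a) x \o g.
have g1_inj : injective g1 by exact: inj_comp perm_inj g_inj.
have g1a : g1 a = x by rewrite /g1 /= tpermL.
exists (tperm (g1 b) y \o g1); split => /=; last by rewrite tpermL.
- exact: inj_comp perm_inj g1_inj.
- by rewrite g1a tpermD 1?eq_sym // -g1a (inj_eq g1_inj).
Qed.

(** * Counting in general multigraphs and their inflations *)

Section Multigraphs.
Variable G : multigraph.

Lemma card_half_edge : #|half_edge G| = (#|edge G| * 2)%N.
Proof. by rewrite card_prod card_bool. Qed.

Lemma sum_degree : (\sum_(v : vertex G) degree v = #|edge G| * 2)%N.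
Proof.
rewrite -card_half_edge -sum1_card.
rewrite (partition_big (fun h : half_edge G => endpt h.1 h.2) xpredT) //=.
apply: eq_bigr => v _; rewrite sum1_card /degree.
by apply: eq_card => h; rewrite !inE.
Qed.

Lemma degree_inflate m (v : vertex G) :
  @degree (inflate m G) v = (degree v * m)%N.
Proof.
rewrite /degree -[in RHS](card_ord m) -[#|{: 'I_m}|]cardsT -cardsX.
pose f (h : edge G * 'I_m * bool) := ((h.1.1, h.2), h.1.2).
have f_inj : injective f by move=> [[? ?] ?] [[? ?] ?] [-> -> ->].
rewrite -(card_imset _ f_inj); apply: eq_card => -[[e b] j].
rewrite !inE /= andbT; apply/imsetP/idP => [[[[e' j'] b']]|].
  by rewrite inE /= => + [-> ->].
by move=> eb; exists ((e, j), b); rewrite ?inE.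
Qed.

Lemma edges_joining_inflate m (u v : vertex G) :
  #|@edges_joining (inflate m G) u v| = (#|edges_joining u v| * m)%N.
Proof.
rewrite -[in RHS](card_ord m) -[#|{: 'I_m}|]cardsT -cardsX.
by apply: eq_card => -[e j]; rewrite !inE andbT.
Qed.

(** Both halves of a negative edge carry the same color, so negative edges of one color share no
    end: each color class is a matching. *)
Lemma card_negative_edges (sigma : signature G) k :
  edge_colorable sigma k ->
  (#|[set e | sigma e == -1]%R| <= k * #|vertex G|./2)%N.
Proof.
case/existsP => gamma /andP[/forallP prop_gamma /forallP sgn_gamma].
have gammaE e b : sigma e = -1 -> gamma (e, b) = gamma (e, false).
  move=> se; case: b => //; apply: val_inj.
  by have /forallP/(_ true)/eqP := sgn_gamma e; rewrite se opprK mul1r.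
rewrite -sum1_card (partition_big (fun e => gamma (e, false)) xpredT) //=.
rewrite -[X in (_ <= X * _)%N](card_colors k) -sum_nat_const.
(* Within one color class, doubling the number of edges counts their half-edges; these inject into
   the vertices by taking endpoints. *)
apply: leq_sum => c _; rewrite sum1_card geq_half_double -muln2 -card_bool.
rewrite -[#|{: bool}|]cardsT -cardsE; set E := [set _ in _]; rewrite -cardsX.
rewrite -(@card_in_imset _ _ (fun h : half_edge G => endpt h.1 h.2)) ?max_card //.
have in_class h : h \in setX E [set: bool] -> gamma h = c.
  case: h => e b; rewrite in_setX !inE andbT unfold_in inE => /andP[/eqP s_e /eqP <-].
  exact: gammaE.
move=> h h' /in_class c_h /in_class c_h' hh'.
have /dinjectiveP := prop_gamma (endpt h.1 h.2); apply; rewrite ?inE //=.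
  by rewrite hh'.
by rewrite c_h c_h'.
Qed.

End Multigraphs.

(** * Complete graphs and their inflations *)

Lemma endpt_complete_inj n (e e' : edge (complete n)) b b' :
  endpt e b = endpt e' b' -> endpt e (~~ b) = endpt e' (~~ b') ->
  e = e' /\ b = b'.
Proof.
case: e e' => [[x y] /= xy] [[x' y'] /= xy'].
(* With equal orientations the two ordered pairs coincide; with opposite ones, $x<y$ and $y<x$ would
   both hold. *)
case: b b' => [] [] /= ? ?; subst; try (by split; first exact: val_inj);
  by move: (ltn_trans xy xy'); rewrite ltnn.
Qed.

Lemma complete_endpts n (u v : 'I_n) : u != v ->
  exists h : half_edge (complete n), endpt h.1 h.2 = u /\ endpt h.1 (~~ h.2) = v.
Proof.
rewrite -val_eqE neq_ltn => /orP[] uv.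
  by exists (Sub (u, v) uv, false).
by exists (Sub (v, u) uv, true).
Qed.

Lemma loopless_endpt (G : multigraph) (e : edge G) b :
  endpt e b != endpt e (~~ b).
Proof. by case: b; rewrite ?loopless // eq_sym loopless. Qed.

Lemma degree_complete n (v : vertex (complete n)) : degree v = n.-1.
Proof.
rewrite /degree -[in RHS](card_ord n) -(cardsC1 (v : 'I_n)).
(* Taking the opposite end matches the half-edges at [v] with the other vertices. *)
rewrite -(@card_in_imset _ _
  (fun h : half_edge (complete n) => endpt h.1 (~~ h.2))); last first.
  move=> [e b] [e' b']; rewrite !inE /= => /eqP ev /eqP ev' ee'.
  by have [-> ->] := endpt_complete_inj (etrans ev (esym ev')) ee'.
apply: eq_card => w; rewrite !inE; apply/imsetP/idP => [[h]|].
  by rewrite inE => /eqP <- ->; rewrite eq_sym; exact: (@loopless_endpt (complete n)).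
rewrite eq_sym => /complete_endpts [h [hv hw]].
by exists h; rewrite ?inE ?hv.
Qed.

Lemma edges_joining_complete n (u v : vertex (complete n)) :
  u != v -> #|edges_joining u v| = 1%N.
Proof.
move=> /complete_endpts[h [hu hv]]; apply/eqP/cards1P; exists h.1.
apply/setP => e; rewrite !inE; apply/existsP/eqP => [[b /andP[/eqP eu /eqP ev]]|->].
  by have [] := endpt_complete_inj (etrans eu (esym hu)) (etrans ev (esym hv)).
by exists h.2; rewrite hu hv !eqxx.
Qed.

Lemma max_degree_inflate_complete m n :
  max_degree (inflate m (complete n.+1)) = (n * m)%N.
Proof.
rewrite /max_degree; under eq_bigr do rewrite degree_inflate degree_complete.
rewrite big_const_ord /=; move: (n * m)%N => d; rewrite -iterS.
by elim: n => [|n IHn]; rewrite iterS ?maxn0 // IHn maxnn.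
Qed.

Lemma max_multiplicity_inflate_complete m n :
  max_multiplicity (inflate m (complete n.+2)) = m.
Proof.
have mult (u v : vertex (complete n.+2)) : u != v ->
    #|@edges_joining (inflate m (complete n.+2)) u v| = m.
  by move=> uv; rewrite edges_joining_inflate edges_joining_complete ?mul1n.
apply/eqP; rewrite eqn_leq; apply/andP; split.
  by apply/bigmax_leqP => u _; apply/bigmax_leqP => v /mult ->.
rewrite -[X in (X <= _)%N](@mult ord0 ord_max) //.
apply: leq_trans (leq_bigmax (ord0 : vertex (inflate m (complete n.+2)))).
by rewrite (@leq_bigmax_cond _ _ _ (ord_max : 'I_n.+2)).
Qed.

(** Handshake count over [n] vertices of equal degree; the doubled form avoids a division. *)
Lemma card_edge_inflate_complete m n :
  (#|edge (inflate m (complete n))| * 2 = n * n.-1 * m)%N.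
Proof.
rewrite -sum_degree; under eq_bigr do rewrite degree_inflate degree_complete.
by rewrite sum_nat_const card_ord mulnA.
Qed.

(** * Both bounds for a single positive edge *)

Section OnePositiveEdge.
Variables (m : nat) (sigma : signature (inflate m (complete 5))).
Variable e0 : edge (inflate m (complete 5)).
Hypothesis sigma_e0 : sigma e0 = 1.
Hypothesis sigma_neq : forall e, e <> e0 -> sigma e = -1.

Lemma leq_edge_colorable k : edge_colorable sigma k -> (5 * m <= k)%N.
Proof.
move=> /card_negative_edges; rewrite card_ord => le_neg.
have cardE : #|edge (inflate m (complete 5))| = (10 * m)%N.
  apply/eqP; rewrite -(@eqn_pmul2r 2) // card_edge_inflate_complete.
  by rewrite [(10 * m * 2)%N]mulnAC.
have neg : [set e | sigma e == -1] = [set~ e0].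
  apply/setP => e; rewrite !inE; case: (e =P e0) => [-> | /sigma_neq ->] //.
  by rewrite sigma_e0.
(* The count gives $10m-1\le 2k$; since $2k$ is even, this already forces $5m\le k$. *)
move: le_neg; rewrite neg cardsC1 cardE [5./2]/=; lia.
Qed.

Lemma edge_colorable_5m : edge_colorable sigma (5 * m).
Proof.
have m_gt0 : (0 < m)%N by case: (e0) => _ [j]; case: (m).
have /mem1_colors/andP[c1 cN1] : (1 < 5 * m)%N by lia.
pose cls (e : edge (inflate m (complete 5))) : 'I_5 * 'I_m :=
  ((endpt e false : 'I_5) + (endpt e true : 'I_5), e.2).
have clsE e b :
    cls e = ((endpt e b : 'I_5) + (endpt e (~~ b) : 'I_5), e.2).
  by case: b; rewrite // /cls addrC.
pose u : 'I_5 := endpt e0 false.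
pose free_cls : 'I_5 * 'I_m := (u + u, e0.2).
(* An edge from [u] to [w] has class sum $u+w$, which differs from $2u$ because $w\ne u$. *)
have cls_neq_free (e : edge (inflate m (complete 5))) b :
    endpt e b = u -> cls e != free_cls.
  move=> eb; rewrite (clsE e b) eb /free_cls xpair_eqE negb_and.
  rewrite (inj_eq (addrI _)) -eb eq_sym.
  by rewrite (@loopless_endpt (inflate m (complete 5)) e b).
(* The opposite colors 1 and -1 go to the two classes that the halves of [e0] will use. *)
have [|||phi [phi_inj phi_free phi_e0]] := @injection_with_two_values _ _
    free_cls (cls e0) (SeqSub c1) (SeqSub cN1).
- by rewrite card_prod !card_ord card_colors.
- by rewrite eq_sym (@cls_neq_free e0 false).
- by [].
(* Only the half of [e0] at [u] is moved; its other half keeps the class of [e0]. *)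
pose gamma := [ffun h : half_edge (inflate m (complete 5)) =>
  phi (if h == (e0, false) then free_cls else cls h.1)].
apply/existsP; exists gamma; apply/andP; split; last first.
  apply/forallP => e; apply/forallP => b; rewrite !ffunE !xpair_eqE.
  case: (e =P e0) => [->|/sigma_neq ->]; last by rewrite opprK mul1r.
  by rewrite sigma_e0; case: b; rewrite /= phi_free phi_e0.
apply/forallP => v; apply/dinjectiveP => h h'; rewrite !inE !ffunE.
move=> /eqP hv /eqP hv' /phi_inj.
(* If exactly one of the two half-edges is the moved one, the other lies at [u] and its class cannot
   be the free one. *)
case: (h =P (e0, false)) (h' =P (e0, false)) => [hE|_] [hE'|_] cls_hh'.
- by rewrite hE hE'.
- have /negP[] := @cls_neq_free h'.1 h'.2 ltac:(by rewrite hv' -hv hE).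
  by rewrite cls_hh'.
- have /negP[] := @cls_neq_free h.1 h.2 ltac:(by rewrite hv -hv' hE').
  by rewrite cls_hh'.
(* With neither moved, cancelling the common end in $\mathbb{Z}/5$ shows that the opposite ends
   agree, and the second components show that the copies do. *)
- move: cls_hh'; rewrite (clsE _ h.2) (clsE _ h'.2) hv hv' => cls_hh'.
  have far := addrI _ (congr1 fst cls_hh').
  have copy : h.1.2 = h'.1.2 := congr1 snd cls_hh'.
  case: h h' hv hv' far copy {cls_hh'} => [[e j] b] [[e' j'] b'] /= hv hv' far ->.
  by have [-> ->] := endpt_complete_inj (etrans hv (esym hv')) far.
Qed.

End OnePositiveEdge.

Theorem mainTheorem2 (m : nat) (hm : (1 <= m)%N)
    (sigma : signature (inflate m (complete 5)))
    (hsigma : exists e0, sigma e0 = 1 /\ (forall e, e <> e0 -> sigma e = -1)) :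
  let G := inflate m (complete 5) in
  chromatic_index sigma = (max_degree G + max_multiplicity G)%N /\
  (max_degree G + max_multiplicity G)%N = (5 * m)%N.
Proof.
move=> G; rewrite /G max_degree_inflate_complete max_multiplicity_inflate_complete.
rewrite -mulSnr; split=> //.
case: hsigma => e0 [sigma_e0 sigma_neq].
rewrite /chromatic_index; case: ex_minnP => k k_col k_min.
apply/eqP; rewrite eqn_leq k_min ?(edge_colorable_5m sigma_e0 sigma_neq) //=.
exact: leq_edge_colorable sigma_e0 sigma_neq _ k_col.
Qed.
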